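(* Let $(\Omega,\mathscr F)$ be a measurable space, $(X,d)$ a metric space, and let $F(\omega,x)=(T(\omega),f_\omega(x))$ be a measurable skew product on $\Omega\times X$, where $T:\Omega\to\Omega$ is measurable and $f_\omega:X\to X$ is Lipschitz for all $\omega\in\Omega$. Let $\bar\mu$ be an $F$-invariant probability measure on $\Omega\times X$ satisfying $$\int\log^+\mathrm{Lip}(f_\omega)\,d\bar\mu<\infty.$$ Then for $\bar\mu$-a.e. $(\omega,x)\in\Omega\times X$ the following holds: if $\lambda(\omega,x)<0$, then for every $\chi>\lambda(\omega,x)$ there exist $\delta=\delta(\omega,x,\chi)>0$ and $C=C(\omega,x,\chi)>0$ such that $$d(f^n_\omega(y),f^n_\omega(z))\le Ce^{n\chi}d(y,z)\qquad\text{for all }y,z\in B(x,\delta)\text{ and all }n\ge0.$$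
   Context: $f^n_\omega(x)$ denotes the second coordinate of $F^n(\omega,x)$, i.e. $f^n_\omega=f_{T^{n-1}\omega}\circ\cdots\circ f_\omega$. For a Lipschitz map $g:X\to X$, $\mathrm{Lip}(g)$ is its Lipschitz constant and $Lg(x)=\lim_{r\to0^+}\mathrm{Lip}(g|_{B(x,r)})$, with $B(x,r)$ the open ball. The (pointwise maximal) Lyapunov exponent is $\lambda(\omega,x)=\limsup_{n\to\infty}\frac1n\log Lf^n_\omega(x)\in[-\infty,\infty]$. All functions being integrated are assumed measurable.
   Formalization: It is additionally assumed that (ω,x) ↦ log Lip(f^n_ω|B(x,r)) is measurable for all n≥1, r>0; this is automatic for separable X, and without such an assumption the claim can fail for nonseparable X. *)

(* Defs.v *)
From HB Require Import structures.
From mathcomp Require Import all_boot all_order all_algebra.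
From mathcomp Require Import all_classical all_reals all_analysis.
From mathcomp Require Import measurable_realfun.
Set Implicit Arguments.
Unset Strict Implicit.
Unset Printing Implicit Defensive.
Import Order.TTheory GRing.Theory Num.Theory.
Import numFieldNormedType.Exports.
Local Open Scope classical_set_scope.
Local Open Scope ring_scope.

(* A measurableType is pointed, so the metric space must be too in order to
   carry its Borel sigma-algebra.  This only excludes the empty space, on which
   there is no probability measure. *)
#[short(type="pointedMetricType")]
HB.structure Definition PointedMetric (K : numDomainType) :=
  { M of Metric K M & Pointed M }.

(* The carrier of X, equipped with the Borel sigma-algebra.  Products
   (Omega * borel X) then carry the product sigma-algebra. *)
Notation borel X := (g_sigma_algebraType (@open X)).

Section lipschitz_constants.
Context {R : realType} {X : pointedMetricType R}.
Implicit Types (g : X -> X) (A : set X) (x : X).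

Definition lipschitz_bound A g (K : R) : Prop :=
  0 <= K /\ forall y z, A y -> A z -> mdist (g y) (g z) <= K * mdist y z.

Definition is_lipschitz g : Prop := exists K, lipschitz_bound setT g K.

(* The least Lipschitz constant of the restriction of g to A, which is +oo if
   that restriction is not Lipschitz, and 0 if A has at most one point. *)
Definition Lip_on A g : \bar R :=
  ereal_inf [set K%:E | K in [set K | lipschitz_bound A g K]].

Definition Lip g : \bar R := Lip_on setT g.

Definition local_Lip g x : \bar R := lim (Lip_on (ball x r) g @[r --> 0^'+]).

End lipschitz_constants.

Section skew_product.
Context {d : measure_display} {Omega : measurableType d}
  {R : realType} {X : pointedMetricType R}.
Variables (T : Omega -> Omega) (f : Omega -> X -> X).

Definition skew_product (p : Omega * borel X) : Omega * borel X :=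
  (T p.1, f p.1 p.2).

Definition cocycle (n : nat) (w : Omega) (x : X) : X :=
  (iter n skew_product (w, x)).2.

(* lne 0 = -oo.  The term n = 0 is irrelevant to the upper limit. *)
Definition lyapunov (w : Omega) (x : X) : \bar R :=
  limn_esup (fun n => (n%:R^-1)%:E * lne (local_Lip (cocycle n w) x))%E.

End skew_product.

Definition invariant_measure d (S : measurableType d) (R : realType)
    (mu : probability S R) (F : S -> S) : Prop :=
  forall A, measurable A -> mu (F @^-1` A) = mu A.

(* Main.v *)
(* Fix a < b < b + e < 0 and let A be the set where the local Lipschitz constants
   of f^n are eventually at most exp(n a + O(1)); it satisfies F^-1(A) `<=` A, so
   by invariance of mu almost every orbit starting in A stays in A.  A point of A
   is good for N if some f^n with n <= N has Lipschitz constant below exp(n b) on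
   the ball of radius 1/(N+1), with log^+ Lip(f) at most N along that stretch.
   Cut an orbit into good blocks and single bad steps: up to a constant, the
   logarithm of the Lipschitz constant of f^n is then at most n b plus the sum of
   log^+ Lip(f) - b over the bad times before n.  Every point of A is good for N
   large, so this cost has small integral by dominated convergence, and the
   maximal ergodic inequality bounds its sums by n e for all n at once, outside a
   set of measure tending to 0 as N grows.  As b + e < 0, the images of the ball
   of radius 1/(N+1) never leave the balls used by the good blocks. *)
Require Import Defs.
From HB Require Import structures.
From mathcomp Require Import all_boot all_order all_algebra.
From mathcomp Require Import all_classical all_reals all_analysis.
From mathcomp Require Import measurable_realfun.
From mathcomp Require Import lra zify.
Set Implicit Arguments.
Unset Strict Implicit.
Unset Printing Implicit Defensive.
Import Order.TTheory GRing.Theory Num.Theory.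
Import numFieldNormedType.Exports.
Local Open Scope classical_set_scope.
Local Open Scope ring_scope.

(** * Invariant measures and the maximal ergodic inequality *)

Section maximal_ergodic_inequality.
Context {d : measure_display} {S : measurableType d} {R : realType}.
Variables (mu : probability S R) (F : S -> S).
Hypothesis mF : measurable_fun setT F.
Hypothesis invF : invariant_measure mu F.
Implicit Types (A : set S) (g : S -> R) (e : R).

Definition orbit_sum g (n : nat) (p : S) : R := \sum_(i < n) g (iter i F p).

(* The maximum over [k <= n] of [orbit_sum g k p - k * e]. *)
Fixpoint max_orbit_sum g e (n : nat) (p : S) : R :=
  if n is n'.+1 then Num.max 0 (g p - e + max_orbit_sum g e n' (F p)) else 0.

Lemma measurable_iter n : measurable_fun setT (iter n F).
Proof.
elim: n => [|n ih]; first exact: measurable_id.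
by apply: (measurableT_comp mF ih).
Qed.

Lemma invariant_measure_iter n : invariant_measure mu (iter n F).
Proof.
elim: n => [//|n ih] A mA.
transitivity (mu (F @^-1` A)); last exact: invF.
by apply: ih; rewrite -(setTI (_ @^-1` _)); exact: mF.
Qed.

Lemma integral_invariant (h : S -> \bar R) :
  measurable_fun setT h -> (forall p, 0 <= h p)%E ->
  (\int[mu]_p h (F p) = \int[mu]_p h p)%E.
Proof.
move=> mh h0; rewrite -[LHS]/(\int[mu]_(p in F @^-1` setT) (h \o F) p)%E.
rewrite -(ge0_integral_pushforward mF)//.
by apply: eq_measure_integral => A mA _; exact: invF.
Qed.

(** The preimage of [A] under [iter n F] lies in [A] and has the same finite measure, so the points
    of [A] that are outside [A] at time [n] form a null set; there are countably many [n]. *)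
Lemma ae_forward_orbit A : measurable A -> F @^-1` A `<=` A ->
  {ae mu, forall p, A p -> forall n, A (iter n F p)}.
Proof.
move=> mA FA.
have FnA n : iter n F @^-1` A `<=` A.
  elim: n => [//|n ih] p; rewrite /= -/(iter n.+1 F p) iterSr => /ih; exact: FA.
have mFn n : measurable (iter n F @^-1` A).
  by rewrite -(setTI (_ @^-1` _)); exact: measurable_iter.
suff : {ae mu, forall p n, A p -> A (iter n F p)}.
  by apply: filterS => p h Ap n; exact: h.
apply: ae_foralln => n; exists (A `\` iter n F @^-1` A); split.
- exact: measurableD.
- rewrite measureD//=; last by rewrite ltey_eq fin_num_measure.
  rewrite setIidr// [X in (_ - X)%E]invariant_measure_iter//.
  by rewrite subee// fin_num_measure.
- by move=> p /= /not_implyP.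
Qed.

Lemma measurable_orbit_sum g n :
  measurable_fun setT g -> measurable_fun setT (orbit_sum g n).
Proof.
move=> mg; apply: measurable_sum => i.
by apply: measurableT_comp => //; exact: measurable_iter.
Qed.

Lemma measurable_orbit_sum_gt g e : measurable_fun setT g ->
  measurable [set p | exists n, n%:R * e < orbit_sum g n p].
Proof.
move=> mg.
rewrite (_ : mkset _ =
    \bigcup_n (setT `&` orbit_sum g n @^-1` `]n%:R * e, +oo[%classic)).
  by apply: bigcup_measurable => n _; exact: measurable_orbit_sum.
apply/seteqP; split=> [p [n h]|p [n _ []]]; last first.
  by rewrite /= in_itv/= andbT => _ h; exists n.
by exists n => //; split=> //; rewrite /= in_itv/= andbT.
Qed.

Lemma max_orbit_sum_ge0 g e n p : 0 <= max_orbit_sum g e n p.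
Proof. by case: n => [|n] //=; rewrite le_max lexx. Qed.

Lemma orbit_sumS g n p : orbit_sum g n.+1 p = g p + orbit_sum g n (F p).
Proof.
by rewrite /orbit_sum big_ord_recl; congr (_ + _); apply: eq_bigr => i _ /=;
  rewrite -iterS iterSr.
Qed.

Lemma orbit_sum_le_max g e n p :
  orbit_sum g n p - n%:R * e <= max_orbit_sum g e n p.
Proof.
elim: n p => [|n ih] p /=; first by rewrite /orbit_sum big_ord0 mul0r subr0.
rewrite le_max; apply/orP; right; rewrite orbit_sumS.
by have := ih (F p); rewrite -natr1; lra.
Qed.

Lemma max_orbit_sum_nd g e n p :
  max_orbit_sum g e n p <= max_orbit_sum g e n.+1 p.
Proof.
elim: n p => [|n ih] p; first by rewrite /= le_max lexx.
have := ih (F p); rewrite /= => h; rewrite ge_max le_max lexx /=.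
by rewrite le_max; apply/orP; right; rewrite lerD2l.
Qed.

Lemma measurable_max_orbit_sum g e n :
  measurable_fun setT g -> measurable_fun setT (max_orbit_sum g e n).
Proof.
move=> mg; elim: n => [|n ih] /=; first exact: measurable_cst.
apply: measurable_maxr; first exact: measurable_cst.
apply: measurable_funD; first exact: measurable_funB.
exact: (measurableT_comp ih mF).
Qed.

Section nonnegative.
Variables (g : S -> R) (e : R).
Hypotheses (mg : measurable_fun setT g) (g0 : forall p, 0 <= g p).
Hypotheses (e0 : 0 < e) (ig : (\int[mu]_p (g p)%:E < +oo)%E).

Let M := max_orbit_sum g e.

Let mM n : measurable_fun setT (fun p => (M n p)%:E).
Proof. by apply/measurable_EFinP; exact: measurable_max_orbit_sum. Qed.

Let mgE : measurable_fun setT (fun p => (g p)%:E).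
Proof. exact/measurable_EFinP. Qed.

Let M0 n p : (0 <= (M n p)%:E)%E.
Proof. by rewrite lee_fin max_orbit_sum_ge0. Qed.

Let int_g_maxF n :
  (\int[mu]_p (g p + M n (F p))%:E =
   \int[mu]_p (g p)%:E + \int[mu]_p (M n p)%:E)%E.
Proof.
rewrite -(integral_invariant (mM n) (M0 n)).
under eq_integral do rewrite EFinD.
rewrite ge0_integralD//; [by move=> p _; rewrite lee_fin|].
exact: (measurableT_comp (mM n) mF).
Qed.

Let mgM n : measurable_fun setT (fun p => (g p + M n (F p))%:E).
Proof.
apply/measurable_EFinP; apply: measurable_funD => //.
by apply: measurableT_comp => //; apply/measurable_EFinP; exact: mM.
Qed.

(** Finiteness is what allows the integral of [M n.+1] to be cancelled in [maximal_n]. It follows by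
    induction from [M n.+1 <= g + M n \o F]. *)
Let int_max_lty n : (\int[mu]_p (M n p)%:E < +oo)%E.
Proof.
elim: n => [|n ih]; first by rewrite integral0_eq.
apply: (@le_lt_trans _ _ (\int[mu]_p (g p + M n (F p))%:E)%E); last first.
  by rewrite int_g_maxF lte_add_pinfty.
apply: ge0_le_integral => //.
move=> p _; rewrite lee_fin /M /= ge_max; apply/andP; split.
  by rewrite addr_ge0// max_orbit_sum_ge0.
by rewrite lerD2r gerBl ltW.
Qed.

Let mpos n : measurable [set p | 0 < M n p].
Proof.
rewrite (_ : [set _ | _] = setT `&` M n @^-1` `]0, +oo[%classic).
  by apply: measurable_max_orbit_sum.
by rewrite setTI; apply/seteqP; split => p /=; rewrite in_itv/= andbT.
Qed.

(* Where [M n.+1 > 0], [M n.+1 = g - e + M n \o F]; integrating cancels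
   [M n \o F] against [M n <= M n.+1]. *)
Let maximal_n n :
  (e%:E * mu [set p | 0 < M n.+1 p]%R <= \int[mu]_p (g p)%:E)%E.
Proof.
set E := [set p | _]; have mE : measurable E by exact: mpos.
have mIE : measurable_fun setT (fun p => (e * \1_E p)%:E).
  by apply/measurable_EFinP; apply: measurable_funM => //;
     exact: measurable_indic.
have e1_ge0 p : (0 <= (e * \1_E p)%:E)%E.
  by rewrite lee_fin mulr_ge0// ltW.
have intE : (\int[mu]_p (e * \1_E p)%:E = e%:E * mu E)%E.
  under eq_integral do rewrite EFinM.
  rewrite ge0_integralZl_EFin//; last 2 first.
    by apply/measurable_EFinP; exact: measurable_indic.
    exact: ltW.
  by rewrite integral_indic// setIT.
have le_int : (\int[mu]_p (M n.+1 p)%:E + e%:E * mu E <=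
    \int[mu]_p (g p)%:E + \int[mu]_p (M n.+1 p)%:E)%E.
  rewrite -intE -ge0_integralD//.
  apply: (@le_trans _ _ (\int[mu]_p (g p + M n (F p))%:E)%E).
    apply: ge0_le_integral => //.
    - by move=> p _; rewrite adde_ge0.
    - exact: emeasurable_funD.
    - move=> p _; rewrite -EFinD lee_fin indicE.
      have [|] := boolP (p \in E); rewrite ?inE ?notin_setE /E /M /=.
        by rewrite /Num.max; case: ifP; lra.
      move/negP; rewrite -leNgt => h.
      by rewrite mulr0 addr0 (le_trans h)// addr_ge0// max_orbit_sum_ge0.
  rewrite int_g_maxF leeD2l// ge0_le_integral// => p _.
  by rewrite lee_fin max_orbit_sum_nd.
move: le_int; rewrite addeC leeD2rE// ge0_fin_numE// integral_ge0//.
Qed.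

(** The sets [0 < M n.+1] increase with [n] and their union contains the set in question, so
    [maximal_n] passes to the limit by continuity from below. *)
Lemma maximal_ergodic :
  (e%:E * mu [set p | exists n, n%:R * e < orbit_sum g n p]%R
    <= \int[mu]_p (g p)%:E)%E.
Proof.
pose E n := [set p | 0 < M n.+1 p].
have ndE : nondecreasing_seq E.
  apply/nondecreasing_seqP => n; apply/subsetPset => p; rewrite /E /=.
  by move/lt_le_trans; apply; exact: max_orbit_sum_nd.
have mE n : measurable (E n) by exact: mpos.
have cvgE : (e%:E * mu (E n) @[n --> \oo] --> e%:E * mu (\bigcup_n E n))%E.
  apply: cvgeZl => //; apply: nondecreasing_cvg_mu => //.
  exact: bigcup_measurable.
apply: (@le_trans _ _ (e%:E * mu (\bigcup_n E n))%E); last first.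
  rewrite -(cvg_lim _ cvgE)//; apply: lime_le.
    by apply/cvg_ex; eexists; exact: cvgE.
  by apply: nearW => n; exact: maximal_n.
rewrite lee_pmul2l//; apply: le_measure; rewrite ?inE.
- exact: measurable_orbit_sum_gt.
- exact: bigcup_measurable.
- move=> p [n h]; exists n => //; rewrite /E /=.
  apply: (lt_le_trans _ (max_orbit_sum_nd _ _ _ _)).
  by apply: (lt_le_trans _ (orbit_sum_le_max _ _ _ _)); rewrite subr_gt0.
Qed.

End nonnegative.

(** The integral of [phi] over [B N] tends to 0 by dominated convergence. The maximal inequality
    bounds by it, up to the factor [e], the measure of the set [E N] of points that fail for [N]; a
    point that fails for every [N] lies in all [E N]. *)
Lemma ae_orbit_sum_tail (phi : S -> R) (B : (set S)^nat) e :
  measurable_fun setT phi -> (forall p, 0 <= phi p) ->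
  (\int[mu]_p (phi p)%:E < +oo)%E -> 0 < e ->
  (forall N, measurable (B N)) -> (forall p, \forall N \near \oo, ~ B N p) ->
  {ae mu, forall p, exists N, forall n,
    orbit_sum (fun q => \1_(B N) q * phi q) n p <= n%:R * e}.
Proof.
move=> mphi phi0 iphi e0 mB Bev.
pose g N q := \1_(B N) q * phi q.
have mg N : measurable_fun setT (g N).
  by apply: measurable_funM => //; exact: measurable_indic.
have g0 N p : 0 <= g N p by rewrite mulr_ge0.
have g_phi N p : g N p <= phi p.
  by rewrite /g ler_piMl// indicE; case: (_ \in _).
have ig N : (\int[mu]_p (g N p)%:E < +oo)%E.
  apply: le_lt_trans iphi; apply: ge0_le_integral => //.
  - by move=> p _; rewrite lee_fin.
  - exact/measurable_EFinP.
  - exact/measurable_EFinP.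
  - by move=> p _; rewrite lee_fin.
have int_cvg : (\int[mu]_p (g N p)%:E @[N --> \oo] --> (0 : \bar R))%E.
  have [| | | | | _ _] := @dominated_convergence _ _ R mu setT measurableT
    (fun N p => (g N p)%:E) (cst 0%E) (fun p => (phi p)%:E).
  - by move=> N; exact/measurable_EFinP.
  - exact: measurable_cst.
  - apply: aeW => p _; apply: cvg_near_cst; near=> N.
    by rewrite /g indicE memNset ?mul0r//; near: N; exact: Bev.
  - apply/integrableP; split; first exact/measurable_EFinP.
    by under eq_integral do rewrite gee0_abs ?lee_fin//.
  - by apply: aeW => p N _; rewrite gee0_abs lee_fin.
  - by rewrite integral0.
pose E N := [set p | exists n, n%:R * e < orbit_sum (g N) n p].
have mE N : measurable (E N) by exact: measurable_orbit_sum_gt.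
exists (\bigcap_N E N); split.
- exact: bigcap_measurable.
- apply/eqP; rewrite eq_le measure_ge0 andbT.
  suff h : (e%:E * mu (\bigcap_N E N) <= 0)%E.
    by rewrite -(pmule_rle0 _ (e0 : 0 < e%:E)%E).
  rewrite -(cvg_lim _ int_cvg)//; apply: lime_ge.
    by apply/cvg_ex; eexists; exact: int_cvg.
  apply: nearW => N; apply: le_trans (maximal_ergodic (mg N) (g0 N) e0 (ig N)).
  rewrite lee_pmul2l//; apply: le_measure; rewrite ?inE//.
  - exact: bigcap_measurable.
  - exact: (mE N).
  - by move=> p; apply.
- move=> p /= h N _; apply: contrapT => nE; apply: h; exists N => n.
  by rewrite leNgt; apply/negP => nlt; apply: nE; exists n.
Unshelve. all: by end_near. Qed.

End maximal_ergodic_inequality.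

(** * Lipschitz constants on sets and at points *)

Section lipschitz_constant_theory.
Context {R : realType} {X : pointedMetricType R}.
Implicit Types (g : X -> X) (A B : set X) (x : X) (K : R).

(** The infimum is attained: every [K + e] with [e > 0] is a Lipschitz bound, and [e] can tend to
    0. *)
Lemma Lip_on_leP A g K : (Lip_on A g <= K%:E)%E <-> lipschitz_bound A g K.
Proof.
split=> [h|h]; last by apply: ereal_inf_lbound; exists K.
have bound e : 0 < e -> lipschitz_bound A g (K + e).
  move=> e0; have : (Lip_on A g < (K + e)%:E)%E.
    by apply: le_lt_trans h _; rewrite lte_fin ltrDl.
  move=> /ereal_inf_lt[_ [K' [K'0 gK'] <-]]; rewrite lte_fin => K'lt.
  split=> [|y z Ay Az]; first by rewrite (le_trans K'0)// ltW.
  by apply: le_trans (gK' y z Ay Az) _; rewrite ler_wpM2r ?mdist_ge0 ?ltW.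
split=> [|y z Ay Az].
  by apply/ler_addgt0Pr => e e0; have [] := bound _ e0.
apply/ler_addgt0Pr => e e0; set D := mdist y z.
have D0 : 0 <= D by exact: mdist_ge0.
(* The denominator is [D + 1] because [D] may vanish. *)
have e'0 : 0 < e / (D + 1) by rewrite divr_gt0// ltr_wpDl.
have [_ /(_ y z Ay Az)] := bound _ e'0.
rewrite mulrDl => /le_trans; apply; rewrite lerD2l -mulrA ler_piMr ?(ltW e0)//.
by rewrite mulrC ler_pdivrMr ?ltr_wpDl// mul1r lerDl.
Qed.

Lemma Lip_on_ge0 A g : (0 <= Lip_on A g)%E.
Proof. by apply: le_ereal_inf_tmp => _ [K [K0 _] <-]; rewrite lee_fin. Qed.

Lemma lipschitz_boundS A B g K :
  A `<=` B -> lipschitz_bound B g K -> lipschitz_bound A g K.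
Proof. by move=> AB [K0 gK]; split=> // y z /AB By /AB Bz; exact: gK. Qed.

Lemma Lip_onS A B g : A `<=` B -> (Lip_on A g <= Lip_on B g)%E.
Proof.
move=> AB; apply: ereal_inf_le_tmp => _ [K gK <-]; exists K => //.
exact: lipschitz_boundS gK.
Qed.

(** [Lip_on (ball x r) g] is monotone in [r], so its limit at [0^'+] is an infimum over radii; any
    radius can be shrunk to some [1/(k+1)]. *)
Lemma local_Lip_lt g x (c : \bar R) : (local_Lip g x < c)%E ->
  exists k : nat, (Lip_on (ball x k.+1%:R^-1) g < c)%E.
Proof.
have nd : {in `]0, +oo[ &, nondecreasing_fun (fun r => Lip_on (ball x r) g)}.
  by move=> r s _ _ rs; apply: Lip_onS => y; rewrite !ballEmdist => /lt_le_trans; apply.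
have /cvg_lim : Lip_on (ball x r) g @[r --> 0^'+] -->
    ereal_inf [set Lip_on (ball x r) g | r in `]0, +oo[%classic].
  exact: (nondecreasing_at_right_cvge +oo%O).
rewrite /local_Lip => -> // /ereal_inf_lt[_ [r] /= + <-].
rewrite in_itv/= andbT => r0 h; have [k kr] := ltr_add_invr r0.
exists k; apply: le_lt_trans h; apply: Lip_onS => y.
by rewrite !ballEmdist => /lt_trans; apply; rewrite add0r in kr.
Qed.

End lipschitz_constant_theory.

Lemma lne_lt_EFin (R : realType) (x : \bar R) (c : R) : (0 <= x)%E ->
  (lne x < c%:E)%E = (x < (expR c)%:E)%E.
Proof.
by move=> x0; rewrite -lte_expeR lneK// in_itv/= x0 leey.
Qed.

(** * The cocycle identity *)

Section cocycle_theory.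
Context {d : measure_display} {Omega : measurableType d}
  {R : realType} {X : pointedMetricType R}.
Variables (T : Omega -> Omega) (f : Omega -> X -> X).
Local Notation F := (skew_product T f).

Lemma iter_skew_product1 n w x : (iter n F (w, x)).1 = iter n T w.
Proof. by elim: n => //= n ->. Qed.

Lemma cocycleD s t w x :
  cocycle T f (s + t) w x = cocycle T f s (iter t T w) (cocycle T f t w x).
Proof.
by rewrite /cocycle iterD -(iter_skew_product1 t w x) -surjective_pairing.
Qed.

Lemma cocycle1 w x : cocycle T f 1 w x = f w x. Proof. by []. Qed.

(** * Good blocks and bad steps along a single orbit *)

Section contraction_along_orbit.
Variables (phi : Omega -> R) (p : Omega * borel X) (B : set (Omega * borel X)).
Variables (b e r : R) (L : nat).
Hypothesis phi0 : forall w, 0 <= phi w.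
Hypothesis phi_lip : forall w, lipschitz_bound setT (f w) (expR (phi w)).
Hypotheses (b0 : b <= 0) (be0 : b + e <= 0) (r0 : 0 < r).

Let D n y z := mdist (cocycle T f n p.1 y) (cocycle T f n p.1 z).
Let x : X := p.2.
Let q t := iter t F p.

Hypothesis good_block : forall t, ~ B (q t) -> exists l, [/\ (0 < l <= L)%N,
  lipschitz_bound (ball (q t).2 r) (cocycle T f l (q t).1) (expR (l%:R * b)) &
  forall j, (j < l)%N -> phi (q (j + t)).1 <= L%:R].

(** The excess of the true expansion [phi] of a bad step over the target rate [b]. *)
Let cost q : R := \1_B q * (phi q.1 - b).

Hypothesis cost_le : forall n, orbit_sum F cost n p <= n%:R * e.

Let q1 t : (q t).1 = iter t T p.1.
Proof. by rewrite /q (surjective_pairing p) iter_skew_product1. Qed.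

Let q2 t : (q t).2 = cocycle T f t p.1 x.
Proof. by rewrite /q /cocycle /x -surjective_pairing. Qed.

Let DS n y z : D n.+1 y z <= expR (phi (q n).1) * D n y z.
Proof.
rewrite /D -add1n !cocycleD -q1 !cocycle1.
by have [_] := phi_lip (q n).1; apply.
Qed.

Let cost_ge0 u : 0 <= cost u.
Proof. by rewrite mulr_ge0// subr_ge0 (le_trans b0). Qed.

Let orbit_cost_nd m n : (m <= n)%N ->
  orbit_sum F cost m p <= orbit_sum F cost n p.
Proof.
move=> mn; rewrite /orbit_sum -(subnKC mn) big_split_ord /= lerDl.
by apply: sumr_ge0 => i _; exact: cost_ge0.
Qed.

(** The invariant kept at the ends of blocks; inside a block only the crude bound [D_within_block]
    is available. *)
Let bounded t := forall y z, ball x r y -> ball x r z ->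
  D t y z <= expR (t%:R * b + orbit_sum F cost t p) * mdist y z.

Let exponent_le t : t%:R * b + orbit_sum F cost t p <= t%:R * (b + e).
Proof. by rewrite mulrDr lerD2l. Qed.

(** Compare [y] with the centre [x]: the factor in [bounded t] is at most 1, since [b + e <= 0]. *)
Let ball_orbit t y : bounded t -> ball x r y ->
  ball (q t).2 r (cocycle T f t p.1 y).
Proof.
move=> bt xy; have := bt x y (ballxx _ r0) xy.
rewrite q2 !ballEmdist /= in xy * => h; apply: le_lt_trans xy.
apply: le_trans h _; rewrite ler_piMl ?mdist_ge0//.
rewrite expR_le1 (le_trans (exponent_le _))//.
by rewrite mulr_ge0_le0.
Qed.

Let D_within_block t l : (forall j, (j < l)%N -> phi (q (j + t)).1 <= L%:R) ->
  forall s y z, (s <= l)%N -> D (s + t) y z <= expR (s%:R * L%:R) * D t y z.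
Proof.
move=> hphi; elim=> [|s ih] y z sl; first by rewrite mul0r expR0 mul1r.
rewrite addSn; apply: le_trans (DS _ _ _) _.
rewrite -natr1 mulrDl mul1r addrC expRD -mulrA.
apply: ler_pM; rewrite ?expR_ge0 ?mdist_ge0//.
  by rewrite ler_expR; exact: hphi.
by apply: ih; exact: ltnW.
Qed.

(** A bad time gives a block of one step, any other time the block of [good_block]. The length bound
    is [L.+1] because a bad step has length 1 even if [L = 0]. *)
Let next_block t : bounded t -> exists l, [/\ (0 < l <= L.+1)%N, bounded (l + t) &
  forall s y z, (s < l)%N -> D (s + t) y z <= expR (L%:R * L%:R) * D t y z].
Proof.
move=> bt; have [Bt|nBt] := pselect (B (q t)).
  exists 1; split=> // [y z xy xz|[|//] y z _].
    rewrite add1n; apply: le_trans (DS _ _ _) _.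
    rewrite /orbit_sum big_ord_recr/= -/(orbit_sum F cost t p) -/(q t).
    rewrite {2}/cost indicE mem_set// mul1r.
    have -> : t.+1%:R * b + (orbit_sum F cost t p + (phi (q t).1 - b)) =
        phi (q t).1 + (t%:R * b + orbit_sum F cost t p) by rewrite -natr1; lra.
    by rewrite expRD -mulrA ler_wpM2l ?expR_ge0//; exact: bt.
  by rewrite add0n ler_peMl ?mdist_ge0// leNgt expR_lt1 -leNgt mulr_ge0.
have [l [/andP[l0 lL] [_ lip] phiL]] := good_block nBt.
exists l; split; first by rewrite l0 leqW.
  move=> y z xy xz; rewrite /D !cocycleD -q1.
  apply: le_trans (lip _ _ (ball_orbit bt xy) (ball_orbit bt xz)) _.
  apply: (@le_trans _ _ (expR (l%:R * b) *
    (expR (t%:R * b + orbit_sum F cost t p) * mdist y z))).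
    by rewrite ler_wpM2l ?expR_ge0//; exact: bt.
  rewrite mulrA -expRD ler_wpM2r ?mdist_ge0// ler_expR natrD mulrDl.
  (* Bad times inside the good block only enlarge the sum, [cost] being nonnegative. *)
  by rewrite addrA lerD2l; apply: orbit_cost_nd; exact: leq_addl.
move=> s y z sl; apply: le_trans (D_within_block phiL _ _ (ltnW sl)) _.
rewrite ler_wpM2r ?mdist_ge0// ler_expR ler_wpM2r// ler_nat.
exact: leq_trans (ltnW sl) lL.
Qed.

Let block_decomposition n : exists t, [/\ (t <= n <= t + L)%N, bounded t &
  forall y z, D n y z <= expR (L%:R * L%:R) * D t y z].
Proof.
(* The induction on [n] carries the block around [n] together with the bound at its end, from which
   the next block starts. *)
suff [t [l [/andP[tn ntl] lL bt _ within]]] : exists t l,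
    [/\ (t <= n < l + t)%N, (l <= L.+1)%N, bounded t, bounded (l + t) &
    forall s y z, (s < l)%N -> D (s + t) y z <= expR (L%:R * L%:R) * D t y z].
  exists t; split => //; first by lia.
  by move=> y z; rewrite -{1}(subnK tn); apply: within; lia.
elim: n => [|n [t [l [/andP[tn]]]]].
  have b00 : bounded 0.
    by move=> y z _ _; rewrite /orbit_sum big_ord0 mul0r add0r expR0 mul1r.
  have [l [/andP[l0 lL] bl within]] := next_block b00.
  by exists 0%N, l; split => //; rewrite addn0.
rewrite leq_eqVlt => /predU1P[nE|nlt] lL bt btl within; last first.
  by exists t, l; split => //; lia.
have [l' [/andP[l'0 l'L] bl' within']] := next_block btl.
by exists (l + t)%N, l'; split => //; lia.
Qed.

Lemma contraction_along_orbit : exists2 C : R, 0 < C & forall y z n,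
  ball x r y -> ball x r z ->
  D n y z <= C * expR (n%:R * (b + e)) * mdist y z.
Proof.
(* [L * L] pays for the steps since the last block start [t]; as [n - t <= L] and [b + e <= 0], the
   other term pays for replacing [t] by [n]. *)
exists (expR (L%:R * L%:R - L%:R * (b + e))) => [|y z n xy xz].
  exact: expR_gt0.
have [t [/andP[tn ntL] bt Dn]] := block_decomposition n.
apply: le_trans (Dn y z) _.
apply: (@le_trans _ _ (expR (L%:R * L%:R) *
    (expR (t%:R * (b + e)) * mdist y z))).
  rewrite ler_wpM2l ?expR_ge0//; apply: le_trans (bt y z xy xz) _.
  by rewrite ler_wpM2r ?mdist_ge0// ler_expR.
rewrite mulrA -!expRD ler_wpM2r ?mdist_ge0// ler_expR -addrA lerD2l.
rewrite -mulNr -mulrDl; apply: ler_wnM2r => //.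
by rewrite addrC lerBlDr -natrD ler_nat.
Qed.

End contraction_along_orbit.

End cocycle_theory.

(** * Contracting and good points *)

Section log_Lipschitz.
Context {d : measure_display} {Omega : measurableType d}
  {R : realType} {X : pointedMetricType R}.
Variables (T : Omega -> Omega) (f : Omega -> X -> X).
Local Notation F := (skew_product T f).

(** This is [log^+ Lip] as a real number; [fine] loses nothing for Lipschitz [f w], by
    [log_LipE]. *)
Definition log_Lip (w : Omega) : R := fine (maxe (lne (Lip (f w))) 0).

Definition log_ball_Lip (n k : nat) (p : Omega * borel X) : \bar R :=
  lne (Lip_on (ball (p.2 : X) k.+1%:R^-1) (cocycle T f n p.1)).

(* Contains [lyapunov < a], but its backward invariance needs no property of
   upper limits. *)
Definition contracting (a : R) : set (Omega * borel X) :=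
  [set p | exists m : nat, forall n, (m <= n)%N ->
    exists k, (log_ball_Lip n.+1 k p < (n%:R * a + m%:R)%:E)%E].

(** A single [N] controls block length, radius and expansion, so that every contracting point is
    good for large [N]. The length is [n.+1] to keep blocks nonempty. *)
Definition good (b : R) (N : nat) : set (Omega * borel X) :=
  [set p | exists2 n, (n < N)%N &
    (log_ball_Lip n.+1 N p < (n.+1%:R * b)%:E)%E /\
    forall j, (j < n.+1)%N -> log_Lip (iter j F p).1 <= N%:R].

Lemma log_ball_Lip_lt n k p c : (log_ball_Lip n k p < c%:E)%E ->
  lipschitz_bound (ball (p.2 : X) k.+1%:R^-1) (cocycle T f n p.1) (expR c).
Proof.
by rewrite /log_ball_Lip lne_lt_EFin ?Lip_on_ge0// => /ltW/Lip_on_leP.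
Qed.

Lemma lipschitz_log_ball_Lip_lt n k p c c' : c < c' ->
  lipschitz_bound (ball (p.2 : X) k.+1%:R^-1) (cocycle T f n p.1) (expR c) ->
  (log_ball_Lip n k p < c'%:E)%E.
Proof.
move=> cc' /Lip_on_leP h; rewrite /log_ball_Lip lne_lt_EFin ?Lip_on_ge0//.
by apply: le_lt_trans h _; rewrite lte_fin ltr_expR.
Qed.

Lemma log_ball_Lip_nonincreasing n k l p :
  (k <= l)%N -> (log_ball_Lip n l p <= log_ball_Lip n k p)%E.
Proof.
move=> kl; rewrite /log_ball_Lip lee_lne ?in_itv/= ?Lip_on_ge0 ?leey//.
apply: Lip_onS => y; rewrite !ballEmdist => /lt_le_trans; apply.
by rewrite lef_pV2 ?posrE// ler_nat.
Qed.

Lemma lyapunov_contracting a p : a < 0 ->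
  (lyapunov T f p.1 p.2 < a%:E)%E -> contracting a p.
Proof.
(* The upper limit is an infimum, over neighbourhoods [V] of infinity, of suprema on [V]; one of
   these is below [a]. *)
move=> a0 /ereal_inf_lt[_ [V [m _ mV] <-] Va]; exists m => n mn.
have nV : V n.+1 by apply: mV; rewrite /= leqW.
have : (lne (local_Lip (cocycle T f n.+1 p.1) p.2) < (n.+1%:R * a)%:E)%E.
  have := le_lt_trans (ereal_sup_ubound (imageP _ nV)) Va.
  rewrite EFinM -lte_pdivrMl//.
rewrite lne_lt_EFin; last first.
  apply: lime_ge; last by apply: nearW => r; exact: Lip_on_ge0.
  apply: nondecreasing_at_right_is_cvge; apply: nearW => r s t _ _ st.
  by apply: Lip_onS => y; rewrite !ballEmdist => /lt_le_trans; apply.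
move=> /local_Lip_lt[k]; rewrite -lne_lt_EFin ?Lip_on_ge0// => h; exists k.
apply: lt_le_trans h _; rewrite lee_fin -natr1.
(* [(n + 1) a <= n a + m] because [a < 0 <= m]. *)
have := ler0n R m; nra.
Qed.

Hypothesis f_lip : forall w, is_lipschitz (f w).

Lemma log_LipE w : (log_Lip w)%:E = maxe (lne (Lip (f w))) 0.
Proof.
rewrite fineK// fin_real// lt_max gt_max ltry ltNyr orbT/= andbT.
have [K /Lip_on_leP LipK] := f_lip w.
by move: LipK; rewrite -/(Lip (f w)); case: (Lip (f w)) => //= s _; case: ifP;
  rewrite ?ltNyr ?ltry.
Qed.

Lemma log_Lip_ge0 w : 0 <= log_Lip w.
Proof. by rewrite -lee_fin log_LipE le_max lexx orbT. Qed.

Lemma lipschitz_log_Lip w : lipschitz_bound setT (f w) (expR (log_Lip w)).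
Proof.
apply/Lip_on_leP; rewrite leNgt; apply/negP => h.
have : (lne (Lip (f w)) <= (log_Lip w)%:E)%E by rewrite log_LipE le_max lexx.
rewrite leNgt => /negP; apply.
by rewrite -lte_expeR lneK// in_itv/= Lip_on_ge0 leey.
Qed.

(** Composing with the first map [f p.1] adds at most [s] to the logarithm, and this is absorbed by
    a larger [m]. *)
Lemma contracting_preimage a : F @^-1` contracting a `<=` contracting a.
Proof.
move=> p [m hm]; set s := log_Lip p.1.
(* Besides [s], the new constant absorbs [- a], from the shift of the index by one. *)
have [m' m'E] : exists m' : nat, m%:R + s - a < m'%:R.
  by exists (Num.truncn `|m%:R + s - a|).+1;
    rewrite (le_lt_trans (ler_norm _))// truncnS_gt.
exists (maxn m.+1 m') => -[|n]; rewrite geq_max// => /andP[mn m'n].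
have [k hk] := hm n mn.
have [_ lip] := log_ball_Lip_lt hk.
have [s0 lips] := lipschitz_log_Lip p.1.
(* On this radius [f p.1] maps into the ball on which [f^(n+1)] is controlled. *)
have rk0 : 0 < (k.+1%:R^-1 : R) / expR s by rewrite divr_gt0// expR_gt0.
have [k' hk'] := ltr_add_invr rk0; rewrite add0r in hk'.
exists k'; apply: (@lipschitz_log_ball_Lip_lt _ _ _ (n%:R * a + m%:R + s)).
  have : m'%:R <= (maxn m.+1 m')%:R :> R by rewrite ler_nat leq_maxr.
  by rewrite -natr1; lra.
have image_ball y : ball (p.2 : X) k'.+1%:R^-1 y ->
    ball ((F p).2 : X) k.+1%:R^-1 (f p.1 y).
  rewrite !ballEmdist /= => py; apply: le_lt_trans (lips _ _ I I) _.
  by rewrite mulrC -ltr_pdivlMr ?expR_gt0//; exact: lt_trans hk'.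
split=> [|y z py pz]; first exact: expR_ge0.
rewrite -addn1 !cocycleD !cocycle1.
apply: le_trans (lip _ _ (image_ball _ py) (image_ball _ pz)) _.
by rewrite [in leRHS]expRD -mulrA ler_wpM2l ?expR_ge0//; exact: lips.
Qed.

Lemma contracting_good a b p : a < b -> contracting a p ->
  \forall N \near \oo, good b N p.
Proof.
move=> ab [m hm].
have ba0 : 0 < b - a by rewrite subr_gt0.
(* For [n >= c] the bound [n a + m] is at most [(n + 1) b]. With [n] and [k] fixed, it remains to
   take [N] above [n], [k] and the sum [M]. *)
pose c := `|(m%:R - b) / (b - a)|.
pose n := maxn m (Num.truncn c).+1.
have [k hk] := hm n (leq_maxl _ _).
have nb : n%:R * a + m%:R <= n.+1%:R * b.
  have : (m%:R - b) / (b - a) <= n%:R.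
    rewrite (le_trans (ler_norm _))// (le_trans (ltW (truncnS_gt _)))//.
    by rewrite ler_nat leq_maxr.
  by rewrite ler_pdivrMr// -natr1; nra.
pose M := \sum_(j < n.+1) log_Lip (iter j F p).1.
near=> N; exists n; first by near: N; exact: nbhs_infty_gt.
split.
  apply: le_lt_trans (log_ball_Lip_nonincreasing _ _ (_ : (k <= N)%N)) _.
    by near: N; exact: nbhs_infty_ge.
  by apply: lt_le_trans hk _; rewrite lee_fin.
move=> j jn; apply: (@le_trans _ _ M).
  rewrite /M (bigD1 (Ordinal jn))//= lerDl.
  by apply: sumr_ge0 => i _; exact: log_Lip_ge0.
by near: N; exact: nbhs_infty_ger.
Unshelve. all: by end_near. Qed.

Hypothesis F_meas : measurable_fun setT F.
Hypothesis log_Lip_meas : measurable_fun setT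
  (fun p : Omega * borel X => log_Lip p.1).
Hypothesis log_ball_Lip_meas : forall n k, (0 < n)%N ->
  measurable_fun setT (log_ball_Lip n k).

Let measurable_log_ball_Lip_lt n k c :
  measurable [set p | (log_ball_Lip n.+1 k p < c%:E)%E].
Proof.
rewrite -[mkset _]setTI; apply: emeasurable_fun_infty_o => //.
exact: log_ball_Lip_meas.
Qed.

Lemma measurable_contracting a : measurable (contracting a).
Proof.
rewrite (_ : contracting a = \bigcup_m \bigcap_(n in [set n | (m <= n)%N])
  \bigcup_k [set p | (log_ball_Lip n.+1 k p < (n%:R * a + m%:R)%:E)%E]).
  apply: bigcup_measurable => m _; apply: bigcap_measurableType => n _.
  exact: bigcup_measurable.
apply/seteqP; split=> [p [m hm]|p [m _ hm]]; exists m => // n mn.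
- by have [k hk] := hm n mn; exists k.
- by have [k _ hk] := hm n mn; exists k.
Qed.

Lemma measurable_good b N : measurable (good b N).
Proof.
rewrite (_ : good b N = \bigcup_(n in [set n | (n < N)%N])
  ([set p | (log_ball_Lip n.+1 N p < (n.+1%:R * b)%:E)%E] `&`
   \bigcap_(j in [set j | (j < n.+1)%N])
     iter j F @^-1` [set p | log_Lip p.1 <= N%:R])).
  apply: bigcup_measurable => n _; apply: measurableI => //.
  apply: bigcap_measurableType => j _.
  rewrite -(setTI (_ @^-1` _)); apply: measurable_iter => //.
  rewrite -[mkset _]setTI -[X in setT `&` X]/(_ @^-1` [set x | x <= N%:R]).
  rewrite -set_itvNyc; exact: log_Lip_meas.
by apply/seteqP; split=> p [n nN hn]; exists n.
Qed.

End log_Lipschitz.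

(** * Almost everywhere contraction, first for fixed exponents *)

Lemma ae_forall_countable (d : measure_display) (S : measurableType d)
    (R : realType) (mu : {measure set S -> \bar R}) (I : countType)
    (P : I -> S -> Prop) :
  (forall i, {ae mu, forall p, P i p}) -> {ae mu, forall p i, P i p}.
Proof.
move=> aeP.
have : {ae mu, forall p (n : nat), if unpickle n is Some i then P i p else True}.
  by apply: ae_foralln => n; case: unpickle => [i|]; [exact: aeP|exact: aeW].
by apply: filterS => p h i; have := h (pickle i); rewrite pickleK.
Qed.

(** The Lyapunov exponent may be [-oo]; then [c - 1] serves as a real lower end. *)
Lemma rat_between_ereal (R : realType) (u : \bar R) (c : R) : (u < c%:E)%E ->
  exists q : rat, (u < (ratr q)%:E)%E /\ ratr q < c.
Proof.
move=> uc; have [z uz zc] : exists2 z : R, (u <= z%:E)%E & z < c.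
  case: u uc => [s|//|_]; last first.
    by exists (c - 1); [rewrite leNye | rewrite gtrBl].
  by rewrite lte_fin => sc; exists s.
have [q] := rat_in_itvoo zc; rewrite in_itv/= => /andP[zq qc].
by exists q; split=> //; apply: le_lt_trans uz _; rewrite lte_fin.
Qed.

Lemma ae_contraction (R : realType) (d : measure_display)
    (Omega : measurableType d) (X : pointedMetricType R) (T : Omega -> Omega)
    (f : Omega -> X -> X) (mu : probability (Omega * borel X)%type R)
    (a c : R) :
  (forall w, is_lipschitz (f w)) ->
  measurable_fun setT (skew_product T f) ->
  invariant_measure mu (skew_product T f) ->
  measurable_fun setT (fun p : Omega * borel X => log_Lip f p.1) ->
  (forall n k, (0 < n)%N -> measurable_fun setT (log_ball_Lip T f n k)) ->
  (\int[mu]_p (log_Lip f p.1)%:E < +oo)%E ->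
  a < c -> c <= 0 ->
  {ae mu, forall p : Omega * borel X, (lyapunov T f p.1 p.2 < a%:E)%E ->
    exists delta C : R, [/\ 0 < delta, 0 < C &
      forall (y z : X) (n : nat),
        ball (p.2 : X) delta y -> ball (p.2 : X) delta z ->
        mdist (cocycle T f n p.1 y) (cocycle T f n p.1 z)
          <= C * expR (n%:R * c) * mdist y z]}.
Proof.
move=> f_lip F_meas F_inv mphi mball iphi ac c0.
pose b := (a + c) / 2; pose e := (c - a) / 2.
have ab : a < b by rewrite /b; lra.
have b0 : b <= 0 by rewrite /b; lra.
have e0 : 0 < e by rewrite /e; lra.
have bec : b + e = c by rewrite /b /e; lra.
(* Removing only contracting points makes every point leave [B N] for large [N]. Almost every orbit
   starting in [contracting] stays there, so its times outside [B N] are good. *)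
pose B N := contracting T f a `\` good T f b N.
have mA : measurable (contracting T f a) by exact: measurable_contracting.
have mB N : measurable (B N).
  by apply: measurableD => //; exact: measurable_good.
have mcost : measurable_fun setT (fun p : Omega * borel X => log_Lip f p.1 - b).
  by apply: measurable_funB => //.
have cost0 (p : Omega * borel X) : 0 <= log_Lip f p.1 - b.
  by rewrite subr_ge0 (le_trans b0)// log_Lip_ge0.
have icost : (\int[mu]_p (log_Lip f p.1 - b)%:E < +oo)%E.
  under eq_integral do rewrite EFinD.
  rewrite ge0_integralD//.
  - apply: lte_add_pinfty => //.
    by rewrite integral_cst// [X in (_ * X)%E](probability_setT mu) mule1 ltry.
  - by move=> p _; rewrite lee_fin log_Lip_ge0.
  - exact/measurable_EFinP.
  - by move=> p _; rewrite lee_fin oppr_ge0.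
have Bev p : \forall N \near \oo, ~ B N p.
  have [Ap|nAp] := pselect (contracting T f a p); last by apply: nearW => N [].
  by apply: filterS (contracting_good f_lip ab Ap) => N gN [].
have tail := ae_orbit_sum_tail F_meas F_inv mcost cost0 icost e0 mB Bev.
have orbit := ae_forward_orbit F_meas F_inv mA (@contracting_preimage _ _ _ _ T _ f_lip a).
apply: filterS2 tail orbit => p [N sumN] orbA lyap.
have Ap : contracting T f a p by apply: lyapunov_contracting lyap; lra.
have r0 : 0 < N.+1%:R^-1 :> R by rewrite invr_gt0.
have blocks t : ~ B N (iter t (skew_product T f) p) -> exists l,
    [/\ (0 < l <= N)%N,
    lipschitz_bound (ball ((iter t (skew_product T f) p).2 : X) N.+1%:R^-1)
      (cocycle T f l (iter t (skew_product T f) p).1) (expR (l%:R * b)) &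
    forall j, (j < l)%N ->
      log_Lip f (iter (j + t) (skew_product T f) p).1 <= N%:R].
  move=> nB; have [n nN [hball hphi]] : good T f b N (iter t (skew_product T f) p).
    by apply: contrapT => ng; apply: nB; split=> //; exact: orbA.
  exists n.+1; split=> //; first exact: log_ball_Lip_lt hball.
  by move=> j jn; rewrite iterD; exact: hphi.
have be0 : b + e <= 0 by rewrite bec.
have [C C0 hC] := contraction_along_orbit (log_Lip_ge0 f_lip)
  (lipschitz_log_Lip f_lip) b0 be0 r0 blocks sumN.
by exists N.+1%:R^-1, C; split=> //; rewrite -bec.
Qed.

Theorem theorem5 (R : realType) (d : measure_display) (Omega : measurableType d)
  (X : pointedMetricType R) (T : Omega -> Omega) (f : Omega -> X -> X)
  (mu : probability (Omega * borel X)%type R)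
  (T_meas : measurable_fun setT T)
  (f_lip : forall w, is_lipschitz (f w))
  (F_meas : measurable_fun setT (skew_product T f))
  (F_inv : invariant_measure mu (skew_product T f))
  (* standing measurability of the functions that get integrated *)
  (logLip_meas : measurable_fun setT
     (fun p : Omega * borel X =>
       maxe (lne (Lip (f p.1))) 0%E : \bar R))
  (logLip_ball_meas : forall (n : nat) (r : R), (0 < n)%N -> 0 < r ->
     measurable_fun setT (fun p : Omega * borel X =>
       lne (Lip_on (ball (p.2 : X) r) (cocycle T f n p.1))))
  (logLip_int : (\int[mu]_p maxe (lne (Lip (f p.1))) 0 < +oo)%E) :
  {ae mu, forall p : Omega * borel X,
    (lyapunov T f p.1 p.2 < 0)%E ->
    forall chi : R, (lyapunov T f p.1 p.2 < chi%:E)%E ->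
    exists delta C : R, [/\ 0 < delta, 0 < C &
      forall (y z : X) (n : nat),
        ball (p.2 : X) delta y -> ball (p.2 : X) delta z ->
        mdist (cocycle T f n p.1 y) (cocycle T f n p.1 z)
          <= C * expR (n%:R * chi) * mdist y z]}.
Proof.
have log_Lip_meas : measurable_fun setT
    (fun p : Omega * borel X => log_Lip f p.1).
  apply/measurable_EFinP; apply: eq_measurable_fun logLip_meas => p _ /=.
  by rewrite log_LipE.
have log_Lip_int : (\int[mu]_p (log_Lip f p.1)%:E < +oo)%E.
  by under eq_integral do rewrite log_LipE//.
(* The null set of [ae_contraction] depends on the exponents; with countably many rational pairs,
   one null set serves every [chi]. *)
have aeP (ac : rat * rat) : {ae mu, forall p : Omega * borel X,
    (ratr ac.1 : R) < ratr ac.2 -> (ratr ac.2 : R) <= 0 ->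
    (lyapunov T f p.1 p.2 < (ratr ac.1)%:E)%E ->
    exists delta C : R, [/\ 0 < delta, 0 < C &
      forall (y z : X) (n : nat),
        ball (p.2 : X) delta y -> ball (p.2 : X) delta z ->
        mdist (cocycle T f n p.1 y) (cocycle T f n p.1 z)
          <= C * expR (n%:R * ratr ac.2) * mdist y z]}.
  have [lt12|] := boolP ((ratr ac.1 : R) < ratr ac.2); last first.
    by move=> _; apply: aeW.
  have [le20|] := boolP ((ratr ac.2 : R) <= 0); last first.
    by move=> _; apply: aeW.
  have log_ball_Lip_meas n k : (0 < n)%N ->
      measurable_fun setT (log_ball_Lip T f n k).
    by move=> n0; apply: logLip_ball_meas => //; rewrite invr_gt0.
  have := ae_contraction f_lip F_meas F_inv log_Lip_meas log_ball_Lip_meas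
    log_Lip_int lt12 le20.
  by apply: filterS => p h _ _; exact: h.
have := ae_forall_countable aeP; apply: filterS => p hp lyap0 chi lyapchi.
(* The minimum with 0 is taken because [chi] may be positive, while [ae_contraction] requires
   [c <= 0]. *)
have [|a [lyapa a_lt]] := @rat_between_ereal _ (lyapunov T f p.1 p.2) (Num.min 0 chi).
  by rewrite EFin_min lt_min lyap0.
have [c' []] := @rat_between_ereal _ (ratr a)%:E _ a_lt.
rewrite lte_fin lt_min => ac /andP[c0 cchi].
have [delta [C [delta0 C0 h]]] := hp (a, c') ac (ltW c0) lyapa.
exists delta, C; split=> // y z n py pz; apply: le_trans (h y z n py pz) _.
by rewrite ler_wpM2r ?mdist_ge0// ler_wpM2l ?(ltW C0)// ler_expR ler_wpM2l// ltW.
Qed.
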